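(* Let $T$ be an $\mathcal{A}_\tau$-labelled transition system, with $\mathcal{A}_\tau$ finite. If $T$ has no divergence up to $\simeq^{\Delta}_b$ and $T$ is unboundedly branching up to $\simeq^{\Delta}_b$, then $T$ is not executable modulo $\simeq^{\Delta}_b$, i.e., there is no RTM $\mathcal{M}$ with $T\simeq^{\Delta}_b\mathcal{T}(\mathcal{M})$.
   Context: An $\mathcal{A}_\tau$-labelled transition system ($\mathcal{A}_\tau=\mathcal{A}\cup\{\tau\}$, $\tau\notin\mathcal{A}$) is $(S,\to,\uparrow)$ with $\to\subseteq S\times\mathcal{A}_\tau\times S$ and initial state $\uparrow$. $\mathit{Reach}(s)$ is the set of states reachable from $s$ by finitely many transitions. Write $s\xrightarrow{(a)}t$ for ''$s\xrightarrow{a}t$, or $a=\tau$ and $s=t$''; $\to^*$, $\to^+$ are the reflexive-transitive and transitive closures of $\xrightarrow{\tau}$. A divergence-preserving branching bisimulation between $(S_1,\to_1,\uparrow_1)$ and $(S_2,\to_2,\uparrow_2)$ is $R\subseteq S_1\times S_2$ such that whenever $s_1Rs_2$: (1) if $s_1\xrightarrow{a}_1s_1'$ then there are $s_2'',s_2'$ with $s_2\to_2^*s_2''\xrightarrow{(a)}s_2'$, $s_1Rs_2''$, $s_1'Rs_2'$; (2) if $s_2\xrightarrow{a}_2s_2'$ then there are $s_1'',s_1'$ with $s_1\to_1^*s_1''\xrightarrow{(a)}s_1'$, $s_1''Rs_2$, $s_1'Rs_2'$; (3) for any infinite $s_1=s_{1,0}\xrightarrow{\tau}s_{1,1}\xrightarrow{\tau}\cdots$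 with $s_{1,i}Rs_2$ for all $i$, there is $s_2'$ with $s_2\to^+s_2'$ and $s_{1,i}Rs_2'$ for some $i$; (4) symmetrically for infinite $\tau$-sequences from $s_2$. States $s,s'$ (possibly of one system) satisfy $s\simeq^{\Delta}_bs'$ if such a relation relates them; systems satisfy $T_1\simeq^{\Delta}_bT_2$ if such a relation relates the initial states. For a state $s$ of $T$, $[s]$ is its $\simeq^{\Delta}_b$-class in $T$, and $\deg(s)$ is the cardinality of $\{(a,[s'])\mid\exists s''.\ s\to^*s''\xrightarrow{a}s',\ s\simeq^{\Delta}_bs'',\ (a=\tau\Rightarrow s''\not\simeq^{\Delta}_bs')\}$. $T$ is boundedly branching up to $\simeq^{\Delta}_b$ if there is $B\in\mathbb{N}$ with $\deg(s)\le B$ for all $s\in\mathit{Reach}(\uparrow)$, and unboundedly branching up to $\simeq^{\Delta}_b$ otherwise. A divergence up to $\simeq^{\Delta}_b$ is an infinite sequence of reachable states $s_1\xrightarrow{\tau}s_2\xrightarrow{\tau}\cdots$ with $s_i\simeq^{\Delta}_bs_j$ for all $i,j$. RTMs: for the finite set $\mathcal{A}_\tau$ and a finite data set $\mathcal{D}$ with blank $\Box\notin\mathcal{D}$, $\mathcal{D}_\Box=\mathcal{D}\cup\{\Box\}$, an RTM is $(S,\to,\uparrow)$ with finite state set $S$, finite set of rules $\to\subseteq S\times\mathcal{D}_\Box\times\mathcal{A}_\tau\times\mathcal{D}_\Box\times\{L,R\}\times S$ (written $s\xrightarrow{a[d/e]M}t$), initial $\uparrow\in S$. $\mathcal{T}(\mathcal{M})$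 has states $(s,\delta)$ with $\delta$ a word over $\mathcal{D}_\Box\cup\{\check d\mid d\in\mathcal{D}_\Box\}$ with exactly one marked symbol, initial state $(\uparrow,\check\Box)$, and transitions $(s,\delta_L\check d\delta_R)\xrightarrow{a}(t,\overleftarrow{\delta_L}e\delta_R)$ iff $s\xrightarrow{a[d/e]L}t$, and $(s,\delta_L\check d\delta_R)\xrightarrow{a}(t,\delta_Le\overrightarrow{\delta_R})$ iff $s\xrightarrow{a[d/e]R}t$, where $\overleftarrow{\delta}$ marks the rightmost symbol of $\delta$ (or is $\check\Box$ if empty) and $\overrightarrow{\delta}$ marks the leftmost (or is $\check\Box$). *)

(* Defs.v *)
From HB Require Import structures.
From mathcomp Require Import all_boot.
From mathcomp Require Import classical_sets cardinality.
From Stdlib Require Import Relation_Operators.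

Set Implicit Arguments.
Unset Strict Implicit.
Unset Printing Implicit Defensive.

Local Open Scope classical_set_scope.
Local Open Scope card_scope.

(** Labels are [option A]: [None] is the silent action tau, [Some a] the visible
    action [a]. *)
Record lts (A : Type) := Lts {
  state : Type;
  trans : state -> option A -> state -> Prop;
  init : state
}.
Arguments trans {A} l _ _ _.
Arguments init {A} l.

Section Lts.
Variables (A : Type) (T : lts A).
Implicit Types (s t : state T) (a : option A).

Definition tau_step s t : Prop := trans T s None t.

Definition tau_star : state T -> state T -> Prop :=
  clos_refl_trans (state T) tau_step.

Definition tau_plus : state T -> state T -> Prop :=
  clos_trans (state T) tau_step.

Definition opt_step s a t : Prop := trans T s a t \/ (a = None /\ s = t).

Definition Reach s : set (state T) :=
  [set t | clos_refl_trans (state T) (fun u v => exists a, trans T u a v) s t].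

Definition tau_path (f : nat -> state T) : Prop :=
  forall i, tau_step (f i) (f i.+1).

End Lts.

Section Bisimulation.
Variables (A : Type) (T1 T2 : lts A).

Definition dp_branching_bisimulation
    (R : state T1 -> state T2 -> Prop) : Prop :=
  forall s1 s2, R s1 s2 ->
  [/\ forall a s1', trans T1 s1 a s1' ->
        exists s2'' s2', [/\ tau_star s2 s2'', opt_step s2'' a s2',
                             R s1 s2'' & R s1' s2'],
      forall a s2', trans T2 s2 a s2' ->
        exists s1'' s1', [/\ tau_star s1 s1'', opt_step s1'' a s1',
                             R s1'' s2 & R s1' s2'],
      forall f : nat -> state T1, f 0 = s1 -> tau_path f ->
        (forall i, R (f i) s2) ->
        exists s2', tau_plus s2 s2' /\ exists i, R (f i) s2'
    & forall f : nat -> state T2, f 0 = s2 -> tau_path f ->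
        (forall i, R s1 (f i)) ->
        exists s1', tau_plus s1 s1' /\ exists i, R s1' (f i)].

Definition dpbb_states (s1 : state T1) (s2 : state T2) : Prop :=
  exists R : state T1 -> state T2 -> Prop,
    dp_branching_bisimulation R /\ R s1 s2.

End Bisimulation.

Definition dpbb_lts (A : Type) (T1 T2 : lts A) : Prop :=
  dpbb_states (init T1) (init T2).

Section Branching.
Variables (A : Type) (T : lts A).
Implicit Types (s : state T).

Definition dpbb_class s : set (state T) := [set t | dpbb_states s t].

(** The set whose cardinality is the branching degree of [s]. *)
Definition deg_set s : set (option A * set (state T)) :=
  [set p | exists a s', p = (a, dpbb_class s') /\
     exists s'', [/\ tau_star s s'', trans T s'' a s', dpbb_states s s''
                   & a = None -> ~ dpbb_states s'' s']].

(** Since [deg_set s] may be infinite, "deg(s) <= B" is stated as a comparison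
    of cardinals with [`I_B] = {0, ..., B-1}. *)
Definition boundedly_branching : Prop :=
  exists B : nat, forall s, Reach (init T) s -> deg_set s #<= `I_B.

Definition unboundedly_branching : Prop := ~ boundedly_branching.

Definition divergence (f : nat -> state T) : Prop :=
  [/\ forall i, Reach (init T) (f i), tau_path f
    & forall i j, dpbb_states (f i) (f j)].

Definition has_divergence : Prop := exists f, divergence f.

End Branching.

Inductive direction := MoveL | MoveR.

Definition bool_of_direction (m : direction) : bool :=
  if m is MoveR then true else false.
Definition direction_of_bool (b : bool) : direction :=
  if b then MoveR else MoveL.
Lemma bool_of_directionK : cancel bool_of_direction direction_of_bool.
Proof. by case. Qed.

HB.instance Definition _ := Finite.copy direction (can_type bool_of_directionK).

(** Tape symbols are [option D], with [None] the blank. A rule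
    s --a[d/e]M--> t is the tuple [(s, d, a, e, M, t)]. *)
Record rtm (A D : finType) := Rtm {
  control : finType;
  rules : {set control * option D * option A * option D * direction * control};
  start : control
}.
Arguments rules {A D} r.
Arguments start {A D} r.

Inductive cell (D : Type) := Plain of option D | Marked of option D.
Arguments Plain {D} _.
Arguments Marked {D} _.

Section Tape.
Variable D : Type.

Definition is_marked (c : cell D) : bool :=
  if c is Marked _ then true else false.

Definition tape : Type := {w : seq (cell D) | count is_marked w == 1}.

Definition plain (w : seq (option D)) : seq (cell D) := map Plain w.

Definition mark_rightmost (w : seq (option D)) : seq (cell D) :=
  if w is d :: w' then rcons (plain (belast d w')) (Marked (last d w'))
  else [:: Marked None].

Definition mark_leftmost (w : seq (option D)) : seq (cell D) :=
  if w is d :: w' then Marked d :: plain w' else [:: Marked None].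

Definition blank_tape : tape := exist _ [:: Marked None] isT.

End Tape.

Section Semantics.
Variables (A D : finType) (M : rtm A D).

Definition rtm_step (c : control M * tape D) (a : option A)
    (c' : control M * tape D) : Prop :=
  exists (dL : seq (option D)) (d : option D) (dR : seq (option D))
         (e : option D),
    sval c.2 = plain dL ++ Marked d :: plain dR /\
    (((c.1, d, a, e, MoveL, c'.1) \in rules M /\
      sval c'.2 = mark_rightmost dL ++ Plain e :: plain dR)
  \/ ((c.1, d, a, e, MoveR, c'.1) \in rules M /\
      sval c'.2 = plain dL ++ Plain e :: mark_leftmost dR)).

Definition rtm_lts : lts A := Lts rtm_step (start M, blank_tape D).

End Semantics.

Definition executable (A : finType) (T : lts A) : Prop :=
  exists (D : finType) (M : rtm A D), dpbb_lts T (rtm_lts M).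

(* Main.v *)
(** Let R relate the initial states of T and T(M), and let s be a reachable
    state of T, related to a configuration m. If every configuration equivalent
    to m could proceed by silent steps to an equivalent configuration, then so
    could every state equivalent to s, giving a divergence of T. Hence some
    configuration m' equivalent to s has no silent step inside its class; all
    moves counted by deg(s) are then matched by direct transitions of m', and
    there are at most as many of those as there are rules of M.

    That bisimilarity is an equivalence compatible with divergence rests on a
    reformulation of conditions (3) and (4): instead of infinite paths, consider
    sets X every element of which reaches X again by a nonempty sequence of
    silent steps. In this form the condition is stable under both composition
    and union. *)

Require Import Defs.
From mathcomp Require Import all_boot.
From mathcomp Require Import boolp classical_sets cardinality.
From Stdlib Require Import Relation_Operators Operators_Properties.

Set Implicit Arguments.
Unset Strict Implicit.
Unset Printing Implicit Defensive.

Local Open Scope classical_set_scope.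
Local Open Scope card_scope.

(** * Silent steps and silent paths *)

Section TauSteps.
Variables (A : Type) (T : lts A).
Implicit Types (s t : state T) (X : set (state T)).

Lemma tau_plusW s t : tau_plus s t -> tau_star s t.
Proof. exact: clos_t_clos_rt. Qed.

Lemma tau_star_plus_trans s t u : tau_star s t -> tau_plus t u -> tau_plus s u.
Proof. exact: clos_rt_t. Qed.

Lemma tau_star_eqVplus s t : tau_star s t -> s = t \/ tau_plus s t.
Proof.
elim=> [x y xy|x|x y z _ IHxy _ IHyz]; [by right; exact: t_step|by left|].
case: IHxy IHyz => [->//|xy] [<-|yz]; right=> //.
exact: t_trans xy yz.
Qed.

Lemma tau_plus_split s t : tau_plus s t ->
  exists2 u, tau_step s u & tau_star u t.
Proof.
elim=> [x y xy|x y z _ [u xu uy] yz _]; first by exists y => //; exact: rt_refl.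
by exists u => //; apply: rt_trans uy _; exact: tau_plusW.
Qed.

Lemma tau_path_within X s : X s ->
  (forall x, X x -> exists2 y, tau_step x y & X y) ->
  exists f, [/\ f 0 = s, tau_path f & forall i, X (f i)].
Proof.
move=> Xs stepX.
have next (x : {x | X x}) : {y : {y | X y} | tau_step (sval x) (sval y)}.
  apply: cid; have [y xy Xy] := stepX _ (svalP x).
  by exists (exist _ y Xy).
pose f n : {x | X x} := iter n (fun x => sval (next x)) (exist _ s Xs).
exists (fun n => sval (f n)); split=> // n; last exact: svalP.
exact: (svalP (next (f n))).
Qed.

Definition tau_returning X :=
  forall x, X x -> exists2 y, tau_plus x y & X y.

End TauSteps.

(** * One-sided simulations and the equivalence properties of bisimilarity *)

Section Simulation.
Variable A : Type.
Implicit Types T : lts A.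

Definition transfers T1 T2 (R : state T1 -> state T2 -> Prop) :=
  forall s t, R s t -> forall a s', trans T1 s a s' ->
  exists t'' t', [/\ tau_star t t'', opt_step t'' a t', R s t'' & R s' t'].

Definition preserves_divergence T1 T2 (R : state T1 -> state T2 -> Prop) :=
  forall X, tau_returning X -> forall s t, X s -> R s t ->
  exists s' t', [/\ X s', tau_plus t t' & R s' t'].

Definition simulation T1 T2 (R : state T1 -> state T2 -> Prop) :=
  transfers R /\ preserves_divergence R.

Definition flip T1 T2 (R : state T1 -> state T2 -> Prop) t s := R s t.

Definition comp T1 T2 T3 (R : state T1 -> state T2 -> Prop)
    (S : state T2 -> state T3 -> Prop) s u :=
  exists2 t, R s t & S t u.

Lemma transfers_star T1 T2 (R : state T1 -> state T2 -> Prop) s s' t :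
  transfers R -> tau_star s s' -> R s t ->
  exists2 t', tau_star t t' & R s' t'.
Proof.
move=> trR ss'; elim: ss' t => [x y xy|x|x y z _ IHxy _ IHyz] t Rxt.
- have [t'' [t' [tt'' step _ Ryt']]] := trR _ _ Rxt _ _ xy.
  exists t' => //; case: step => [t''t'|[_ <-//]].
  by apply: rt_trans tt'' _; exact: rt_step.
- by exists t => //; exact: rt_refl.
- have [t1 tt1 /IHyz[t2 t1t2 Rzt2]] := IHxy _ Rxt.
  by exists t2 => //; exact: rt_trans tt1 t1t2.
Qed.

Lemma transfers_opt_step T1 T2 (R : state T1 -> state T2 -> Prop) s a s' t :
  transfers R -> R s t -> opt_step s a s' ->
  exists t'' t', [/\ tau_star t t'', opt_step t'' a t', R s t'' & R s' t'].
Proof.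
move=> trR Rst [|[-> <-]]; first exact: trR.
by exists t, t; split=> //; [exact: rt_refl|right].
Qed.

Lemma simulation_comp T1 T2 T3 (R : state T1 -> state T2 -> Prop)
    (S : state T2 -> state T3 -> Prop) :
  simulation R -> simulation S -> simulation (comp R S).
Proof.
move=> [trR divR] [trS divS]; split.
  move=> s u [t Rst Stu] a s' ss'.
  have [t'' [t' [tt'' t''t' Rst'' Rs't']]] := trR _ _ Rst _ _ ss'.
  have [v uv St''v] := transfers_star trS tt'' Stu.
  have [u'' [u' [vu'' u''u' ? ?]]] := transfers_opt_step trS St''v t''t'.
  exists u'', u'; split=> //; first exact: rt_trans uv vu''.
    by exists t''.
  by exists t'.
move=> X Xret s u Xs [t Rst Stu].
(* The image of a returning set under [R] is returning, so it can be handed on to [S]; a mere match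
   of an infinite path would not yield a path to pass on. *)
pose Y t := exists2 s, X s & R s t.
have Yret : tau_returning Y.
  move=> y [x Xx Rxy].
  have [x' [y' [Xx' yy' Rx'y']]] := divR _ Xret _ _ Xx Rxy.
  by exists y' => //; exists x'.
have Yt : Y t by exists s.
have [y [u' [[x Xx Rxy] uu' Syu']]] := divS _ Yret _ _ Yt Stu.
by exists x, u'; split=> //; exists y.
Qed.

(* If the conclusion fails, then [t] matches all the steps of a silent path that
   keeps returning to [X] without moving, contradicting condition (3). *)
Lemma bisimulation_preserves_divergence T1 T2
    (R : state T1 -> state T2 -> Prop) :
  dp_branching_bisimulation R -> preserves_divergence R.
Proof.
move=> bisR X Xret s t Xs Rst; apply: contrapT => stay.
have trR : transfers R by move=> x y /bisR[].
(* The silent paths between visits to [X] may leave [X]; [W] contains their intermediate states, so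
   it can be traversed by single steps. *)
pose W x := exists2 y, tau_star x y & X y.
have stayW x t' : W x -> tau_plus t t' -> ~ R x t'.
  move=> [y xy Xy] tt' Rxt'; apply: stay.
  have [t'' t't'' Ryt''] := transfers_star trR xy Rxt'.
  exists y, t''; split=> //.
  by case: (tau_star_eqVplus t't'') => [<-//|]; exact: t_trans.
have stepWR x : W x /\ R x t -> exists2 y, tau_step x y & W y /\ R y t.
  move=> [[y xy Xy] Rxt].
  have [z xz Wz] : exists2 z, tau_step x z & W z.
    (* If [x] is already in [X], the first step is taken on the way to the next visit. *)
    case: (tau_star_eqVplus xy) => [eqxy|/tau_plus_split[z xz zy]].
      move: Xy; rewrite -eqxy => /Xret[w /tau_plus_split[z xz zw] Xw].
      by exists z => //; exists w.
    by exists z => //; exists y.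
  exists z => //; split=> //.
  have [t'' tt'' Rzt''] := transfers_star trR (rt_step _ _ _ _ xz) Rxt.
  by case: (tau_star_eqVplus tt'') => [->//|/(stayW _ _ Wz)].
have WRs : W s /\ R s t by split=> //; exists s => //; exact: rt_refl.
have [f [f0 fpath WRf]] :=
  tau_path_within (X := fun x => W x /\ R x t) WRs stepWR.
have [_ _ divR _] := bisR _ _ Rst.
have [t' [tt' [i Rft']]] := divR f f0 fpath (fun i => (WRf i).2).
exact: stayW (WRf i).1 tt' Rft'.
Qed.

Lemma bisimulation_flip T1 T2 (R : state T1 -> state T2 -> Prop) :
  dp_branching_bisimulation R -> dp_branching_bisimulation (flip R).
Proof.
move=> bisR t s /bisR[trR trR' divR divR']; split.
- by move=> a t' /trR'[s'' [s' []]]; exists s'', s'.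
- by move=> a s' /trR[t'' [t' []]]; exists t'', t'.
- exact: divR'.
- exact: divR.
Qed.

Lemma dp_branching_bisimulationP T1 T2 (R : state T1 -> state T2 -> Prop) :
  dp_branching_bisimulation R <-> simulation R /\ simulation (flip R).
Proof.
have simR S1 S2 (Q : state S1 -> state S2 -> Prop) :
    dp_branching_bisimulation Q -> simulation Q.
  move=> bisQ; split; last exact: bisimulation_preserves_divergence.
  by move=> s t /bisQ[].
split=> [bisR|[[trR divR] [trR' divR']] s t Rst].
  by split; apply: simR => //; exact: bisimulation_flip.
(* Back to infinite paths: the range of a path is a returning set. *)
have path_returning S (f : nat -> state S) :
    tau_path f -> tau_returning (range f).
  move=> fpath _ [i _ <-]; exists (f i.+1); last by exists i.+1.
  exact: t_step.
split; first exact: trR.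
- move=> a t' tt'.
  by have [s'' [s' []]] := trR' _ _ Rst _ _ tt'; exists s'', s'.
- move=> f f0 /path_returning fret _.
  have fs : range f s by exists 0.
  have [_ [t' [[i _ <-] tt' Rft']]] := divR _ fret _ _ fs Rst.
  by exists t'; split=> //; exists i.
- move=> f f0 /path_returning fret _.
  have ft : range f t by exists 0.
  have [_ [s' [[i _ <-] ss' Rs'f]]] := divR' _ fret _ _ ft Rst.
  by exists s'; split=> //; exists i.
Qed.

Lemma dpbb_sym T1 T2 (s : state T1) (t : state T2) :
  dpbb_states s t -> dpbb_states t s.
Proof.
move=> [R [bisR Rst]]; exists (flip R); split=> //.
exact: bisimulation_flip.
Qed.

(** Stability under union: each condition starts from one related pair, and the bisimulation
    containing that pair supplies the whole answer. *)
Lemma dpbb_simulation T1 T2 : simulation (@dpbb_states A T1 T2).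
Proof.
split=> [s t [R [bisR Rst]] a s' ss'|X Xret s t Xs [R [bisR Rst]]].
  have [trR _ _ _] := bisR _ _ Rst; have [t'' [t' [? ? ? ?]]] := trR _ _ ss'.
  by exists t'', t'; split=> //; exists R.
have [s' [t' [? ? ?]]] :=
  bisimulation_preserves_divergence bisR Xret Xs Rst.
by exists s', t'; split=> //; exists R.
Qed.

Lemma simulation_ext T1 T2 (R S : state T1 -> state T2 -> Prop) :
  (forall s t, R s t <-> S s t) -> simulation R -> simulation S.
Proof.
move=> RS; suff -> : R = S by [].
by apply/funext => s; apply/funext => t; exact/propext.
Qed.

Lemma dpbb_trans T1 T2 T3 (s : state T1) (t : state T2) (u : state T3) :
  dpbb_states s t -> dpbb_states t u -> dpbb_states s u.
Proof.
move=> st tu; exists (comp (@dpbb_states A T1 T2) (@dpbb_states A T2 T3)).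
split; last by exists t.
apply/dp_branching_bisimulationP; split.
  by apply: simulation_comp; exact: dpbb_simulation.
apply: (simulation_ext
  (R := comp (@dpbb_states A T3 T2) (@dpbb_states A T2 T1))).
  by move=> x z; split=> -[y xy yz]; exists y; exact: dpbb_sym.
by apply: simulation_comp; exact: dpbb_simulation.
Qed.

Lemma dpbb_refl T (s : state T) : dpbb_states s s.
Proof.
have eq_sim : simulation (fun x y : state T => x = y).
  split=> [x _ <- a x' xx'|X Xret x _ Xx <-].
    by exists x, x'; split=> //; [exact: rt_refl|left].
  by have [y xy Xy] := Xret _ Xx; exists y, y.
exists (fun x y => x = y); split=> //.
apply/dp_branching_bisimulationP; split=> //.
by apply: simulation_ext eq_sim => x y; split=> ->.
Qed.

(** Adding the pair [(s, u)] to bisimilarity gives a bisimulation: [u] answers [s] by first moving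
    to [s'], and [s] answers [u] by first moving to [u] itself. *)
Lemma dpbb_stuttering T (s u s' : state T) :
  tau_star s u -> tau_star u s' -> dpbb_states s s' -> dpbb_states s u.
Proof.
move=> su us' ss'.
have [trB divB] := @dpbb_simulation T T.
pose R (x y : state T) := dpbb_states x y \/ x = s /\ y = u.
exists R; split; last by right.
apply/dp_branching_bisimulationP; split; split.
- move=> x y Rxy a x' xx'.
  have [z yz xz] : exists2 z, tau_star y z & dpbb_states x z.
    case: Rxy => [xy|[-> ->]]; first by exists y => //; exact: rt_refl.
    by exists s'.
  have [y'' [y' [zy'' ? ? ?]]] := trB _ _ xz _ _ xx'.
  by exists y'', y'; split=> //; [exact: rt_trans yz zy''|left|left].
- move=> X Xret x y Xx Rxy.
  have [z yz xz] : exists2 z, tau_star y z & dpbb_states x z.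
    case: Rxy => [xy|[-> ->]]; first by exists y => //; exact: rt_refl.
    by exists s'.
  have [x' [y' [Xx' zy' ?]]] := divB _ Xret _ _ Xx xz.
  by exists x', y'; split=> //; [exact: tau_star_plus_trans zy'|left].
- move=> x y [/dpbb_sym xy|[-> ->]] a x' xx'.
    have [y'' [y' [? ? /dpbb_sym ? /dpbb_sym ?]]] := trB _ _ xy _ _ xx'.
    by exists y'', y'; split=> //; left.
  by exists u, x'; split=> //; left=> //; exact: dpbb_refl.
- move=> X Xret x y Xx [/dpbb_sym xy|[yE xE]].
    have [x' [y' [? ? /dpbb_sym ?]]] := divB _ Xret _ _ Xx xy.
    by exists x', y'; split=> //; left.
  have [x' xx' Xx'] := Xret _ Xx; exists x', x'; split=> //.
    by apply: tau_star_plus_trans xx'; rewrite yE xE.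
  by left; exact: dpbb_refl.
Qed.

(** * Stable states and their branching degree *)

Lemma dpbb_reach T1 T2 (s s' : state T1) (t : state T2) :
  Reach s s' -> dpbb_states s t -> exists t' : state T2, dpbb_states s' t'.
Proof.
move=> ss'; elim: ss' t => [x y [a xy]|x|x y z _ IHxy _ IHyz] t xt.
- have [_ [t' [_ _ _ yt']]] := (@dpbb_simulation T1 T2).1 _ _ xt _ _ xy.
  by exists t'.
- by exists t.
- by have [t' /IHyz] := IHxy _ xt.
Qed.

Lemma divergence_of_returning_class T (s : state T) :
  Reach (init T) s -> tau_returning (dpbb_class s) -> has_divergence T.
Proof.
move=> reach_s ret.
have stepC x : dpbb_class s x -> exists2 y, tau_step x y & dpbb_class s y.
  move=> sx; have [y /tau_plus_split[z xz zy] sy] := ret _ sx.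
  (* The first state on a silent path from [x] back to the class is in the class by stuttering. *)
  exists z => //; apply: (dpbb_trans sx).
  apply: dpbb_stuttering (rt_step _ _ _ _ xz) zy _.
  exact: dpbb_trans (dpbb_sym sx) sy.
have [f [f0 fpath fC]] := tau_path_within (dpbb_refl s) stepC.
exists f; split=> // [|i j]; last exact: dpbb_trans (dpbb_sym (fC i)) (fC j).
elim=> [|i IHi]; first by rewrite f0.
by apply: rt_trans IHi _; apply: rt_step; exists None; exact: fpath.
Qed.

Lemma dpbb_stable T1 T2 (s : state T1) (t : state T2) :
  ~ has_divergence T1 -> Reach (init T1) s -> dpbb_states s t ->
  exists2 t' : state T2, dpbb_states s t' &
    forall u, tau_plus t' u -> ~ dpbb_states s u.
Proof.
move=> nodiv reach_s st; apply: contrapT => nostable; apply: nodiv.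
apply: (divergence_of_returning_class reach_s) => x sx.
pose X (u : state T2) := dpbb_states s u.
have Xret : tau_returning X.
  move=> u su; apply: contrapT => noret; apply: nostable.
  by exists u => // v uv sv; apply: noret; exists v.
(* Divergence is carried back from [T2] to [T1]: [x] must answer the returning set [X] with a
   nonempty silent path. *)
have [v [y [sv xy vy]]] := (@dpbb_simulation T2 T1).2 _ Xret _ _ st
  (dpbb_trans (dpbb_sym st) sx).
by exists y => //; exact: dpbb_trans vy.
Qed.

(** Stability forbids silent moves of [t] before the matching step, and an idle match would make the
    counted step inert. The class [C] is expressed through [t'] alone, which prepares the count. *)
Lemma deg_set_stable T1 T2 (s : state T1) (t : state T2) a C :
  dpbb_states s t -> (forall u, tau_plus t u -> ~ dpbb_states s u) ->
  deg_set s (a, C) ->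
  exists2 t', trans T2 t a t' & C = [set x | dpbb_states x t'].
Proof.
move=> st stable [_ [s' [[<- ->] [s'' [ss'' s''s' simss'' inert]]]]].
have s''t := dpbb_trans (dpbb_sym simss'') st.
have [t'' [t' [tt'' step s''t'' s't']]] :=
  (@dpbb_simulation T1 T2).1 _ _ s''t _ _ s''s'.
have eqt : t = t''.
  case: (tau_star_eqVplus tt'') => // /stable[].
  exact: dpbb_trans s''t''.
exists t'.
  rewrite eqt; case: step => // -[aN eqt'']; case: inert => //.
  by apply: dpbb_trans s''t'' _; rewrite eqt''; exact: dpbb_sym.
apply/seteqP; split=> x /=; first by move/dpbb_sym/dpbb_trans; apply.
by move/dpbb_sym; exact: dpbb_trans.
Qed.

End Simulation.

(** * Counting the moves of a Turing machine configuration *)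

Lemma marked_split_inj (D : Type) (dL dL' dR dR' : seq (option D)) d d' :
  plain dL ++ Marked d :: plain dR = plain dL' ++ Marked d' :: plain dR' ->
  [/\ dL = dL', d = d' & dR = dR'].
Proof.
have plain_inj : injective (@plain D) by apply: inj_map => x y [].
elim: dL dL' => [|x dL IH] [|x' dL'] //= [].
  by move=> -> /plain_inj ->.
by move=> -> /IH[-> -> ->].
Qed.

Section RtmDegree.
Variables (A D : finType) (M : rtm A D).

Definition rule : Type :=
  control M * option D * option A * option D * direction * control M.

Definition rule_label (r : rule) : option A := r.1.1.1.2.

Definition fires (r : rule) (w w' : control M * tape D) :=
  let: (c, d, a, e, m, c') := r in
  [/\ w.1 = c, w'.1 = c' & exists dL dR,
    sval w.2 = plain dL ++ Marked d :: plain dR /\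
    sval w'.2 = if m is MoveL then mark_rightmost dL ++ Plain e :: plain dR
                else plain dL ++ Plain e :: mark_leftmost dR].

(** The single marked cell fixes the splitting of the tape, hence what the rule writes and where the
    head goes. *)
Lemma fires_functional r w w1 w2 : fires r w w1 -> fires r w w2 -> w1 = w2.
Proof.
case: r w w1 w2 => [[[[[c d] a] e] m] c'] [? w] [? w1] [? w2] /=.
move=> [_ -> [dL [dR [-> w1E]]]] [_ -> [dL' [dR' [/marked_split_inj[<- _ <-]]]]].
by rewrite -w1E => /val_inj ->.
Qed.

Lemma rtm_step_fires w a w' : rtm_step w a w' ->
  exists r, [/\ r \in rules M, rule_label r = a & fires r w w'].
Proof.
move=> [dL [d [dR [e [wE [[inM w'E]|[inM w'E]]]]]]].
  by exists (w.1, d, a, e, MoveL, w'.1); split=> //; split=> //; exists dL, dR.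
by exists (w.1, d, a, e, MoveR, w'.1); split=> //; split=> //; exists dL, dR.
Qed.

Lemma card_deg_set_rtm (T : lts A) (s : state T) (w : state (rtm_lts M)) :
  dpbb_states s w -> (forall u, tau_plus w u -> ~ dpbb_states s u) ->
  deg_set s #<= `I_#|rules M|.
Proof.
move=> sw stable.
(* A total function of the rule: a rule that does not fire at [w] gets the empty set, and one that
   fires gets a genuine class because its result is unique. *)
pose successor r : option A * set (state T) :=
  (rule_label r, [set x | exists2 w' : state (rtm_lts M),
                            fires r w w' & dpbb_states x w']).
(* Only indices below the number of rules are used, so the default pair is never reached. *)
pose F := nth (None, set0) [seq successor r | r <- enum (rules M)].
apply: card_le_trans (card_image_le F `I_#|rules M|).
apply: subset_card_le => -[a C] /(deg_set_stable sw stable)[w' ww' ->].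
have [r [rM <- rww']] := rtm_step_fires ww'.
have r_enum : r \in enum (rules M) by rewrite mem_enum.
exists (index r (enum (rules M))); first by rewrite /= cardE index_mem.
rewrite /F (nth_map r) ?index_mem // nth_index // /successor; congr (_, _).
apply/seteqP; split=> x /=; last by exists w'.
by move=> [w'' /fires_functional/(_ rww') ->].
Qed.

End RtmDegree.

Theorem theorem12 (A : finType) (T : lts A) :
  ~ has_divergence T -> unboundedly_branching T -> ~ executable T.
Proof.
move=> nodiv unbounded [D [M TM]]; apply: unbounded.
exists #|rules M| => s reach_s.
have [w sw] := dpbb_reach reach_s TM.
have [w' sw' stable] := dpbb_stable nodiv reach_s sw.
exact: card_deg_set_rtm sw' stable.
Qed.
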